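(* As formal power series in $x$, $$\sum_{n\ge 0}|\mathcal{M}_n(P_3,P_4,P_5)|\,x^n=\frac{(1-x)^2}{1-3x+2x^2-x^3}.$$
   Context: A matching with $n$ arcs is a partition of $\{1,2,\ldots,2n\}$ into blocks of size 2, called arcs; an arc is written $[a,b]$ with $a<b$, where $a$ is its opener and $b$ its closer. For $n=0$ there is exactly one (empty) matching. A matching is Stoimenow if it contains no pair of arcs $[i,\ell],[i+1,k]$ with $i+1<k<\ell$ (Type 1) and no pair of arcs $[k,j+1],[\ell,j]$ with $k<\ell<j$ (Type 2). A matching $M$ contains a pattern (a matching) $P$ with $m$ arcs if some $m$ arcs of $M$ become $P$ after their $2m$ endpoints are relabelled $1,\ldots,2m$ in the order-preserving way; otherwise $M$ avoids $P$. $\mathcal{M}_n(Q_1,\ldots,Q_r)$ denotes the set of Stoimenow matchings with $n$ arcs avoiding every one of $Q_1,\ldots,Q_r$. The patterns are $P_3=\{[1,2],[3,5],[4,6],[7,8]\}$, $P_4=\{[1,2],[3,5],[4,7],[6,8]\}$, $P_5=\{[1,3],[2,5],[4,6],[7,8]\}$. *)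

(* Defs.v *)
From mathcomp Require Import all_boot all_order all_algebra.

Set Implicit Arguments.
Unset Strict Implicit.
Unset Printing Implicit Defensive.

Import GRing.Theory.

(* The point of {1, ..., 2n} with label a is the ordinal of value a - 1. *)
Notation arcs n := {set {set 'I_(2 * n)}}.

Definition matching n (M : arcs n) : bool :=
  partition M [set: 'I_(2 * n)] && [forall B in M, #|B| == 2].

Definition is_arc n (M : arcs n) (a b : 'I_(2 * n)) : bool :=
  (a < b) && ([set a; b] \in M).

(* Arcs [i,l] and [i+1,k] with i+1 < k < l. *)
Definition type1 n (M : arcs n) : bool :=
  [exists i : 'I_(2 * n), exists i' : 'I_(2 * n),
   exists k : 'I_(2 * n), exists l : 'I_(2 * n),
    [&& i' == i.+1 :> nat, is_arc M i l, is_arc M i' k, i' < k & k < l]].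

(* Arcs [k,j+1] and [l,j] with k < l < j. *)
Definition type2 n (M : arcs n) : bool :=
  [exists j : 'I_(2 * n), exists j' : 'I_(2 * n),
   exists k : 'I_(2 * n), exists l : 'I_(2 * n),
    [&& j' == j.+1 :> nat, is_arc M k j', is_arc M l j, k < l & l < j]].

Definition stoimenow n (M : arcs n) : bool :=
  [&& matching M, ~~ type1 M & ~~ type2 M].

(* f sends each new label to the endpoint of S that receives it. *)
Definition relabels_to n m (S : arcs n) (P : arcs m) : bool :=
  [exists f : {ffun 'I_(2 * m) -> 'I_(2 * n)},
    [forall i : 'I_(2 * m), forall j : 'I_(2 * m), (i < j) ==> (f i < f j)]
    && (S == [set f @: (B : {set _}) | B in P])].

Definition contains n m (M : arcs n) (P : arcs m) : bool :=
  [exists S : arcs n, [&& S \subset M, #|S| == m & relabels_to S P]].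

(* A pattern is packed with its number of arcs. *)
Definition pattern := {m : nat & arcs m}.
Definition Pattern m (P : arcs m) : pattern := existT (fun m => arcs m) m P.

Definition stoimenow_avoiding n (Qs : seq pattern) : {set arcs n} :=
  [set M : arcs n |
    stoimenow M && all (fun Q : pattern => ~~ contains M (projT2 Q)) Qs].

(* Here a and b are labels in {1, ..., 2n}. *)
Definition arc n (a b : nat) : {set 'I_(2 * n)} :=
  [set i : 'I_(2 * n) | (i.+1 == a) || (i.+1 == b)].

Definition P3 : arcs 4 := [set arc 4 1 2; arc 4 3 5; arc 4 4 6; arc 4 7 8].
Definition P4 : arcs 4 := [set arc 4 1 2; arc 4 3 5; arc 4 4 7; arc 4 6 8].
Definition P5 : arcs 4 := [set arc 4 1 3; arc 4 2 5; arc 4 4 6; arc 4 7 8].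

Local Ltac all_points :=
  apply/setP => -[[|[|[|[|[|[|[|[|?]]]]]]]] ?]; by rewrite !inE.

Lemma arc_card4 a b : 0 < a -> a < b -> b < 9 -> #|arc 4 a b| = 2.
Proof.
move=> a0 ab b9; have la : a.-1 < 2 * 4 by case: a a0 ab => // a _ /=; move/ltnW/leq_trans; apply.
have lb : b.-1 < 2 * 4 by case: b ab b9.
rewrite (_ : arc 4 a b = [set Ordinal la; Ordinal lb]).
  by rewrite cards2 -val_eqE /=; case: a a0 ab {la} => // a _; case: b {b9 lb} => //= b; rewrite ltnS neq_ltn => ->.
apply/setP => i; rewrite !inE -!val_eqE /=.
by case: a a0 ab {la} => // a _; case: b {b9 lb}.
Qed.

Local Ltac explicit_matching :=
  apply/andP; split;
  [ apply/and3P; split;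
    [ by rewrite /cover !bigcup_setU !big_set1; apply/eqP; all_points
    | apply/trivIsetP => A B; rewrite !inE -!orbA;
      case/or4P => /eqP ->; case/or4P => /eqP ->; rewrite ?eqxx // => _;
      rewrite -setI_eq0; apply/eqP; all_points
    | by apply/negP; rewrite !inE -!orbA; case/or4P => /eqP /(congr1 (fun A : {set _} => #|A|));
      rewrite arc_card4 // cards0 ]
  | by apply/forall_inP => A; rewrite !inE -!orbA;
    case/or4P => /eqP ->; rewrite arc_card4 ].

Lemma P3_matching : matching P3. Proof. by explicit_matching. Qed.
Lemma P4_matching : matching P4. Proof. by explicit_matching. Qed.
Lemma P5_matching : matching P5. Proof. by explicit_matching. Qed.

Local Open Scope ring_scope.

(* The formal power series \sum_n (f n) x^n is represented by f; two series are
   equal when f =1 g. *)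
Definition fps (R : Type) := nat -> R.

Definition fps_of_poly (R : nzRingType) (p : {poly R}) : fps R := fun n => p`_n.

Definition fps_mul (R : pzRingType) (f g : fps R) : fps R :=
  fun n => \sum_(i < n.+1) f i * g (n - i)%N.

(* The list of the first n coefficients of the inverse of f, computed from
   \sum_(i <= n) g_i f_(n-i) = 0 for n > 0. *)
Fixpoint fps_inv_coefs (R : unitRingType) (f : fps R) (n : nat) : seq R :=
  if n is n'.+1 then
    let s := fps_inv_coefs f n' in
    rcons s (((n' == 0%N)%:R - \sum_(i < n') s`_i * f (n' - i)%N) / f 0%N)
  else [::].

Definition fps_inv (R : unitRingType) (f : fps R) : fps R :=
  fun n => (fps_inv_coefs f n.+1)`_n.

Definition fps_div (R : unitRingType) (f g : fps R) : fps R :=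
  fps_mul f (fps_inv g).

Lemma size_fps_inv_coefs (R : unitRingType) (f : fps R) n :
  size (fps_inv_coefs f n) = n.
Proof. by elim: n => //= n IHn; rewrite size_rcons IHn. Qed.

Lemma nth_fps_inv_coefs (R : unitRingType) (f : fps R) n i :
  (i < n)%N -> (fps_inv_coefs f n)`_i = fps_inv f i.
Proof.
elim: n => // n IHn; rewrite ltnS leq_eqVlt => /predU1P[-> //|lt_in].
by rewrite /= nth_rcons size_fps_inv_coefs lt_in IHn.
Qed.

Lemma fps_invE (R : unitRingType) (f : fps R) n :
  fps_inv f n =
    ((n == 0%N)%:R - \sum_(i < n) fps_inv f i * f (n - i)%N) / f 0%N.
Proof.
rewrite {1}/fps_inv /= nth_rcons size_fps_inv_coefs ltnn eqxx.
congr ((_ - _) / _); apply: eq_bigr => i _.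
by rewrite nth_fps_inv_coefs.
Qed.

Lemma fps_mulVf (R : unitRingType) (f : fps R) :
  f 0%N \is a GRing.unit -> fps_mul (fps_inv f) f =1 fps_of_poly 1.
Proof.
move=> f0 n; rewrite /fps_mul big_ord_recr /= subnn [X in _ + X * _]fps_invE.
by rewrite divrK // addrC subrK /fps_of_poly coef1.
Qed.

(* Main.v *)
Require Import Defs.
From HB Require Import structures.
From mathcomp Require Import all_boot all_order all_algebra.
From mathcomp Require Import zify lra.
Set Implicit Arguments.
Unset Strict Implicit.
Unset Printing Implicit Defensive.
Import GRing.Theory.

(** The matchings to be counted turn out to be very rigid, and this rigidity
turns them into the words of a regular language whose generating function is the
stated fraction.

Call an opener early if no closer precedes it, a closer late if no opener follows
it, and an arc outer if its opener is early or its closer is late. A Stoimenow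
matching avoids the three patterns exactly when every arc that is not outer joins
two neighbouring positions ([avoiding_tame], [tame_avoiding]). Indeed each pattern
contains an arc of length at least 2 with one arc entirely to its left and another
entirely to its right, and such an arc is not outer. Conversely, if [p, q] is not
outer and q > p + 1, the arc through p + 1, together with suitable arcs to the left
of p and to the right of q, produces a pattern or a forbidden pair of neighbours.

In a Stoimenow matching no outer arc lies strictly below another arc
([nested_inner]). Hence the outer arcs match the k-th outer opener with the k-th
outer closer, and the matching is determined by marking each position as opener or
closer, outer or inner ([eq_labels]). The sequences of marks that occur are those
of the form O^i u C^j, where O and C mark the outer openers and closers, such that
neighbouring marks satisfy a local condition, O and C are equally frequent, and C
occurs at most i times in u ([labels_balanced], [labels_realization]). The last
condition says that the closers that are not late can all be served by early
openers.

Now give one letter to each arc: an early arc whose closer is not late, a late arc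
whose opener is not early, a short inner arc, or an arc that is both early and
late. Listing the first three kinds in the order in which they occur in u, and then
the arcs of the last kind, gives a bijection onto the words accepted by a small
automaton ([word_labels_inj], [balanced_word_labels]). Counting the accepted words
of length n by the transfer method gives a(n+3) + 2 a(n+1) = 3 a(n+2) + a(n), which
is the recurrence encoded by the denominator ([fps_of_recurrent]). *)

(** * Formal power series and the recurrence *)

Section PowerSeries.
Local Open Scope ring_scope.

(** Truncations transfer the ring laws of polynomials to power series. *)
Lemma fps_mulE (R : nzRingType) (f g : fps R) N n : (n < N)%N ->
  fps_mul f g n = ((\poly_(i < N) f i) * (\poly_(i < N) g i))`_n.
Proof.
move=> ltnN; rewrite coefM; apply: eq_bigr => i _; rewrite !coef_poly.
by rewrite !(leq_ltn_trans _ ltnN) ?leq_subr // -ltnS.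
Qed.

Lemma fps_mulA (R : nzRingType) (f g h : fps R) :
  fps_mul f (fps_mul g h) =1 fps_mul (fps_mul f g) h.
Proof.
move=> n; pose P (u : fps R) := \poly_(i < n.+1) u i.
have PE u i : (i < n.+1)%N -> (P u)`_i = u i by move=> lt_i; rewrite coef_poly lt_i.
transitivity ((P f * (P g * P h))`_n).
  rewrite coefM; apply: eq_bigr => i _.
  by rewrite PE // (fps_mulE _ _ (N := n.+1)) // ltnS leq_subr.
rewrite mulrA coefM; apply: eq_bigr => i _.
by rewrite PE ?ltnS ?leq_subr // (fps_mulE _ _ (N := n.+1)).
Qed.

Lemma fps_mulr1 (R : nzRingType) (f : fps R) : fps_mul f (fps_of_poly 1) =1 f.
Proof.
move=> n; rewrite /fps_mul big_ord_recr /= subnn /fps_of_poly coef1 mulr1.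
rewrite big1 ?add0r // => i _.
by rewrite coef1 subn_eq0 leqNgt ltn_ord mulr0.
Qed.

Lemma fps_mulC (R : comNzRingType) (f g : fps R) : fps_mul f g =1 fps_mul g f.
Proof. by move=> n; rewrite !(fps_mulE _ _ (ltnSn n)) mulrC. Qed.

Lemma eq_fps_mul (R : nzRingType) (f f' g g' : fps R) :
  f =1 f' -> g =1 g' -> fps_mul f g =1 fps_mul f' g'.
Proof. by move=> ff gg n; apply: eq_bigr => i _; rewrite ff gg. Qed.

(** The inverse of q is defined by a recursion on coefficients; multiplying by it on the
left is undone because the product is associative and commutative. *)
Lemma fps_divP (R : comUnitRingType) (f p q : fps R) :
  q 0%N \is a GRing.unit -> fps_mul f q =1 p -> f =1 fps_div p q.
Proof.
move=> q0 fq n; rewrite /fps_div -(eq_fps_mul fq (fun=> erefl _)) -fps_mulA.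
rewrite -[LHS]fps_mulr1; apply: eq_fps_mul => // i.
by rewrite fps_mulC fps_mulVf.
Qed.
End PowerSeries.

Definition recurrent (a : nat -> nat) : Prop :=
  forall n, a n.+3 + 2 * a n.+1 = 3 * a n.+2 + a n.

(** A cubic recurrence says that multiplication by the denominator kills all
coefficients from degree 3 on; the three initial values give the numerator. *)
Lemma fps_of_recurrent (a : nat -> nat) :
  a 0 = 1 -> a 1 = 1 -> a 2 = 2 -> recurrent a ->
  (fun n => (a n)%:R : rat)%R =1
    fps_div (fps_of_poly ((1 - 'X) ^+ 2))
            (fps_of_poly (1 - 3%:R *: 'X + 2%:R *: 'X^2 - 'X^3)).
Proof.
move=> a0 a1 a2 rec; apply: fps_divP.
  by rewrite /fps_of_poly !coefE /= !mulr0 subr0 addr0 subr0 unitr1.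
have qE k : fps_of_poly (1 - 3%:R *: 'X + 2%:R *: 'X^2 - 'X^3)%R k =
   (nth 0 [:: 1; -3%:R; 2%:R; -1] k)%R :> rat.
  rewrite /fps_of_poly !coefE; case: k => [|[|[|[|k]]]] //=.
  by rewrite nth_nil !mulr0 !subr0.
have pE k : fps_of_poly ((1 - 'X) ^+ 2)%R k = (nth 0 [:: 1; -2%:R; 1] k)%R :> rat.
  rewrite /fps_of_poly sqrrB mul1r expr1n !coefE.
  by case: k => [|[|[|k]]] //=; rewrite nth_nil.
move=> n; rewrite pE /fps_mul.
have -> : (\sum_(i < n.+1) (a i)%:R *
    fps_of_poly (1 - 3%:R *: 'X + 2%:R *: 'X^2 - 'X^3) (n - i)%N =
  \sum_(i < n.+1) (a i)%:R * nth 0 [:: 1; -3%:R; 2%:R; -1] (n - i)%N :> rat)%R.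
  by apply: eq_bigr => i _; rewrite qE.
case: n => [|[|[|n]]]; rewrite ?big_ord_recr ?big_ord0 /= ?a0 ?a1 ?a2 //.
rewrite big1; last first.
  move=> i _; rewrite nth_default ?mulr0 //=; have := ltn_ord i; lia.
have [E3 E2 E1] : [/\ n.+3 - n = 3, n.+3 - n.+1 = 2 & n.+3 - n.+2 = 1]%N.
  by split; lia.
rewrite nth_nil subnn E3 E2 E1 /=.
have /(congr1 (fun k => k%:R : rat)%R) := rec n.
rewrite /= natrD [in RHS]natrD (natrM _ 2) (natrM _ 3); lra.
Qed.

(** * Matchings as involutions without fixed points *)

Section Partner.
Variables (n : nat) (M : arcs n).

Definition partner (x : 'I_(2 * n)) : 'I_(2 * n) :=
  odflt x [pick y | (y != x) && ([set x; y] \in M)].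

Hypothesis matchM : matching M.

Lemma matching_block_uniq (B B' : {set 'I_(2 * n)}) x :
  B \in M -> B' \in M -> x \in B -> x \in B' -> B = B'.
Proof.
case/andP: matchM => /and3P[_ tiM _] _ BM B'M xB xB'.
by rewrite -(def_pblock tiM BM xB) -(def_pblock tiM B'M xB').
Qed.

Lemma partner_ex x : exists2 y, y != x & [set x; y] \in M.
Proof.
case/andP: matchM => /and3P[/eqP covM tiM _] /forall_inP card2.
have xM : x \in cover M by rewrite covM inE.
have BM : pblock M x \in M by rewrite pblock_mem.
have xB : x \in pblock M x by rewrite mem_pblock.
have /cards2P[a [b [neq_ab defB]]] := card2 _ BM.
rewrite defB in BM xB; move: xB; rewrite !inE => /orP[] /eqP->.
  by exists b; rewrite // eq_sym.
by exists a; rewrite // setUC.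
Qed.

Lemma partnerP x : (partner x != x) /\ ([set x; partner x] \in M).
Proof.
rewrite /partner; case: pickP => [y /andP[]//|none].
by have [y nyx yM] := partner_ex x; have := none y; rewrite nyx yM.
Qed.

Lemma partner_neq x : partner x != x. Proof. by case: (partnerP x). Qed.

Lemma partner_arc x : [set x; partner x] \in M.
Proof. by case: (partnerP x). Qed.

Lemma eq_partner x y : y != x -> [set x; y] \in M -> partner x = y.
Proof.
move=> neq_yx yM; have := matching_block_uniq yM (partner_arc x).
move/(_ x); rewrite !inE eqxx => /(_ isT isT)/setP/(_ y).
by rewrite !inE eqxx orbT (negPf neq_yx) => /esym/eqP.
Qed.

Lemma partnerK : involutive partner.
Proof.
by move=> x; apply: eq_partner; rewrite 1?eq_sym ?partner_neq // setUC partner_arc.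
Qed.

Lemma is_arcE x y : is_arc M x y = (x < y) && (partner x == y).
Proof.
rewrite /is_arc; case: ltnP => //= lt_xy; apply/idP/eqP => [xyM|<-].
  by apply: eq_partner; rewrite // -val_eqE neq_ltn lt_xy orbT.
exact: partner_arc.
Qed.

Lemma matchingE : M = [set [set x; partner x] | x : 'I_(2 * n)].
Proof.
apply/setP => B; apply/idP/imsetP => [BM|[x _ ->]]; last exact: partner_arc.
have /andP[_ /forall_inP/(_ _ BM)/cards2P[a [b [neq_ab defB]]]] := matchM.
by exists a => //; rewrite (@eq_partner a b) 1?eq_sym -?defB.
Qed.
End Partner.

Lemma eq_matching n (M M' : arcs n) :
  matching M -> matching M' -> partner M =1 partner M' -> M = M'.
Proof.
move=> mM mM' eqp; rewrite (matchingE mM) (matchingE mM').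
by apply: eq_imset => x; rewrite eqp.
Qed.

Section OfInvolution.
Variables (n : nat) (g : 'I_(2 * n) -> 'I_(2 * n)).
Hypotheses (gK : involutive g) (g_neq : forall x, g x != x).

Definition matching_of : arcs n := [set [set x; g x] | x : 'I_(2 * n)].

Lemma matching_ofP : matching matching_of.
Proof.
have g_inj := inv_inj gK.
apply/andP; split; last first.
  apply/forall_inP => B /imsetP[x _ ->].
  by rewrite cards2 (eq_sym x) g_neq.
apply/and3P; split.
- apply/eqP/setP => x; rewrite inE; apply/bigcupP.
  by exists [set x; g x]; [exact: imset_f | rewrite !inE eqxx].
- apply/trivIsetP => A B /imsetP[x _ ->] /imsetP[y _ ->] neqAB.
  rewrite -setI_eq0; apply: contraNT neqAB => /set0Pn[z].
  rewrite !inE => /andP[/orP[] /eqP-> /orP[] /eqP].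
  + by move->.
  + by move->; rewrite gK setUC.
  + by move<-; rewrite gK setUC.
  + by move/g_inj->.
- by apply/imsetP => -[x _] /setP/(_ x); rewrite !inE eqxx.
Qed.

Lemma partner_matching_of : partner matching_of =1 g.
Proof.
move=> x; apply: (eq_partner matching_ofP (g_neq x)).
exact: imset_f.
Qed.
End OfInvolution.

(** * Openers, closers and outer arcs *)

Section Stoimenow.
Variables (n : nat) (M : arcs n).
Hypothesis matchM : matching M.
Local Notation g := (partner M).
Implicit Types x y z : 'I_(2 * n).

Definition opener x := x < g x.

(** [early x] and [late x] include that x itself is an opener, respectively a
closer. *)
Definition early x := [forall y : 'I_(2 * n), (y <= x) ==> opener y].
Definition late x := [forall y : 'I_(2 * n), (x <= y) ==> ~~ opener y].

(** A property of the arc through x, expressed at either endpoint. *)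
Definition outer x :=
  if opener x then early x || late (g x) else early (g x) || late x.

Lemma openerF x : ~~ opener x = (g x < x).
Proof. by rewrite /opener -leqNgt leq_eqVlt val_eqE (negPf (partner_neq matchM x)). Qed.

Lemma opener_partner x : opener (g x) = ~~ opener x.
Proof. by rewrite openerF /opener partnerK. Qed.

Lemma outer_partner x : outer (g x) = outer x.
Proof. by rewrite /outer opener_partner partnerK //; case: opener. Qed.

Lemma early_le x y : y <= x -> early x -> early y.
Proof.
move=> le_yx /forallP ex; apply/forallP => z; apply/implyP => le_zy.
by apply: (implyP (ex z)); apply: leq_trans le_zy le_yx.
Qed.

Lemma late_ge x y : x <= y -> late x -> late y.
Proof.
move=> le_xy /forallP lx; apply/forallP => z; apply/implyP => le_yz.
by apply: (implyP (lx z)); apply: leq_trans le_xy le_yz.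
Qed.

Lemma early_opener x : early x -> opener x.
Proof. by move/forallP/(_ x)/implyP; apply. Qed.

Lemma late_closer x : late x -> ~~ opener x.
Proof. by move/forallP/(_ x)/implyP; apply. Qed.

Lemma earlyPn x : ~~ early x -> exists2 y : 'I_(2 * n), y <= x & ~~ opener y.
Proof. by case/forallPn => y; rewrite negb_imply => /andP[]; exists y. Qed.

Lemma latePn x : ~~ late x -> exists2 y : 'I_(2 * n), x <= y & opener y.
Proof. by case/forallPn => y; rewrite negb_imply negbK => /andP[]; exists y. Qed.

(** Two neighbouring openers have distinct partners, so avoiding nesting means that
the partners increase. *)
Lemma type1P : reflect (forall x x', x' = x.+1 :> nat ->
    opener x -> opener x' -> g x < g x') (~~ type1 M).
Proof.
apply: (iffP idP) => [no1 x x' x'E ox ox'|incr].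
  apply: contraNT no1; rewrite -leqNgt leq_eqVlt => /orP[|lt_g].
    rewrite val_eqE (inj_eq (inv_inj (partnerK matchM))) => /eqP.
    by move/(congr1 (@nat_of_ord _)); lia.
  apply/existsP; exists x; apply/existsP; exists x'.
  apply/existsP; exists (g x'); apply/existsP; exists (g x).
  by apply/and5P; split; rewrite ?is_arcE ?eqxx ?andbT //; exact/eqP.
apply/negP => /existsP[i /existsP[i' /existsP[k /existsP[l]]]].
rewrite !is_arcE //.
case/and5P=> [/eqP i'E /andP[lt_il /eqP gi] /andP[lt_ik /eqP gi'] _].
by apply/negP; rewrite -leqNgt ltnW // -gi -gi' incr // /opener ?gi ?gi'.
Qed.

Lemma type2P : reflect (forall x x', x' = x.+1 :> nat ->
    ~~ opener x -> ~~ opener x' -> g x < g x') (~~ type2 M).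
Proof.
apply: (iffP idP) => [no2 x x' x'E ox ox'|incr].
  apply: contraNT no2; rewrite -leqNgt leq_eqVlt => /orP[|lt_g].
    rewrite val_eqE (inj_eq (inv_inj (partnerK matchM))) => /eqP.
    by move/(congr1 (@nat_of_ord _)); lia.
  apply/existsP; exists x; apply/existsP; exists x'.
  apply/existsP; exists (g x'); apply/existsP; exists (g x).
  rewrite !openerF in ox ox'.
  by rewrite x'E eqxx !is_arcE // !partnerK // !eqxx ox ox' lt_g.
apply/negP => /existsP[j /existsP[j' /existsP[k /existsP[l]]]].
rewrite !is_arcE //.
case/and5P=> [/eqP j'E /andP[lt_il /eqP gk] /andP[lt_ik /eqP gl] + _].
have gj : g j = l by rewrite -gl partnerK.
have gj' : g j' = k by rewrite -gk partnerK.
apply/negP; rewrite -leqNgt ltnW // -gj -gj' incr //.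
  by rewrite openerF gj.
by rewrite openerF gj'.
Qed.
End Stoimenow.

Section Monotone.
Variables (n : nat) (M : arcs n).
Hypothesis stM : stoimenow M.
Local Notation g := (partner M).
Implicit Types x y z : 'I_(2 * n).

Lemma stoimenow_matching : matching M. Proof. by case/and3P: stM. Qed.
Local Hint Resolve stoimenow_matching : core.

Lemma opener_incr x y : y = x.+1 :> nat ->
  opener M x -> opener M y -> g x < g y.
Proof. by case/and3P: stM => _ /(type1P stoimenow_matching) incr _; apply: incr. Qed.

Lemma closer_incr x y : y = x.+1 :> nat ->
  ~~ opener M x -> ~~ opener M y -> g x < g y.
Proof. by case/and3P: stM => _ _ /(type2P stoimenow_matching) incr; apply: incr. Qed.

(** Everything to the left of an early opener is an opener, so the comparison of
neighbouring openers can be chained from x to y. *)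
Lemma early_incr x y : early M y -> x < y -> g x < g y.
Proof.
have [k le_yk] := ubnP (y : nat); elim: k => // k IHk in y le_yk * => ey lt_xy.
have lt_y1 : y.-1 < 2 * n by apply: leq_ltn_trans (ltn_ord y); apply: leq_pred.
have y1E : y = (Ordinal lt_y1).+1 :> nat by rewrite /= prednK //; lia.
have ey1 : early M (Ordinal lt_y1) by apply: early_le ey; rewrite /=; lia.
have lt_g := opener_incr y1E (early_opener ey1) (early_opener ey).
have [->//|neq_xy1] := eqVneq x (Ordinal lt_y1).
apply: ltn_trans lt_g; apply: IHk => //=; first lia.
by move: neq_xy1; rewrite -val_eqE /=; lia.
Qed.

Lemma late_incr x y : late M x -> x < y -> g x < g y.
Proof.
have [k le_xk] := ubnP (2 * n - x); elim: k => // k IHk in x le_xk * => lx lt_xy.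
have lt_x1 : x.+1 < 2 * n by apply: leq_ltn_trans (ltn_ord y).
have lx1 : late M (Ordinal lt_x1) by apply: late_ge lx => /=.
have lt_g := @closer_incr x (Ordinal lt_x1) erefl (late_closer lx) (late_closer lx1).
have [->//|neq_yx1] := eqVneq y (Ordinal lt_x1).
apply: ltn_trans lt_g _; apply: IHk => //=; first lia.
by move: neq_yx1; rewrite -val_eqE /=; lia.
Qed.

(** If y were early, the increase of partners over the first openers would forbid
the nesting; if g y were late, the increase over the last closers would. *)
Lemma nested_inner x y : opener M y -> x < y -> g y < g x -> ~~ outer M y.
Proof.
move=> oy lt_xy lt_g; rewrite /outer oy negb_or; apply/andP; split.
  by apply/negP => /early_incr /(_ lt_xy); lia.
by apply/negP => /late_incr /(_ lt_g); rewrite !partnerK //; lia.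
Qed.
End Monotone.

(** * Pattern containment *)

Section Containment.
Variables (n m : nat) (M : arcs n) (P : arcs m).

(** The subset of arcs in the definition of containment is the image of P, and it has
the right size because an increasing map is injective. *)
Lemma containsP : #|P| = m ->
  reflect (exists f : 'I_(2 * m) -> 'I_(2 * n),
             {homo f : i j / i < j} /\ forall B, B \in P -> f @: B \in M)
          (contains M P).
Proof.
move=> cardP; apply: (iffP existsP) => [[S /and3P[sSM _ /existsP[f]]]|[f [f_incr fP]]].
  case/andP=> /forallP f_incr /eqP defS; exists f; split.
    by move=> i j; move/forallP/(_ j)/implyP: (f_incr i); apply.
  by move=> B BP; apply: (subsetP sSM); rewrite defS; apply/imsetP; exists B.
have f_inj : injective f.
  move=> i j eq_f; apply: contra_eq (erefl (f i)); rewrite -val_eqE => neq_ij.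
  by move: neq_ij; rewrite neq_ltn => /orP[] /f_incr; rewrite ?eq_f; lia.
pose F := [ffun i => f i].
have FE (B : {set 'I_(2 * m)}) : F @: B = f @: B by apply: eq_imset => i; rewrite ffunE.
exists [set F @: (B : {set _}) | B in P]; apply/and3P; split.
- by apply/subsetP => _ /imsetP[B BP ->]; rewrite FE fP.
- rewrite card_in_imset ?cardP // => A B _ _; rewrite !FE; exact: imset_inj.
- apply/existsP; exists F; rewrite eqxx andbT.
  apply/forallP => i; apply/forallP => j; apply/implyP => lt_ij.
  by rewrite !ffunE f_incr.
Qed.

Lemma card_matching : matching P -> #|P| = m.
Proof.
case/andP=> partP /forall_inP card2.
have := card_uniform_partition (n := 2) (fun B BP => eqP (card2 B BP)) partP.
rewrite cardsT card_ord; lia.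
Qed.
End Containment.

Lemma arcE m a b (lt_a : a < 2 * m) (lt_b : b < 2 * m) :
  Defs.arc m a.+1 b.+1 = [set Ordinal lt_a; Ordinal lt_b].
Proof. by apply/setP => i; rewrite !inE !eqSS -!val_eqE. Qed.

Lemma contains_arcsP n (M : arcs n) m (P : arcs m) (l : seq (nat * nat)) :
  matching M -> matching P ->
  all (fun p => p.1 < p.2 < 2 * m) l ->
  (forall B, (B \in P) = (B \in [seq Defs.arc m p.1.+1 p.2.+1 | p <- l])) ->
  reflect (exists f : 'I_(2 * m) -> 'I_(2 * n), {homo f : i j / i < j} /\
     forall i j : 'I_(2 * m), (val i, val j) \in l -> partner M (f i) = f j)
    (contains M P).
Proof.
move=> mM mP /allP lP PE; apply: (iffP (containsP M (card_matching mP))).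
  case=> f [f_incr fP]; exists f; split=> // i j ijl.
  have /= /andP[lt_ij _] := lP _ ijl.
  have /fP : Defs.arc m i.+1 j.+1 \in P by rewrite PE; apply/mapP; exists (val i, val j).
  rewrite (arcE (ltn_ord i) (ltn_ord j)) imsetU1 imset_set1 => ijM.
  have eq_o (k : 'I_(2 * m)) (lt : k < 2 * m) : Ordinal lt = k by apply: val_inj.
  rewrite !eq_o in ijM; apply: eq_partner ijM => //.
  by rewrite -val_eqE neq_ltn (f_incr _ _ lt_ij) orbT.
case=> f [f_incr fP]; exists f; split=> // B.
rewrite PE => /mapP[[a b] abl ->] /=.
have /= /andP[lt_ab lt_b] := lP _ abl.
have lt_a := ltn_trans lt_ab lt_b.
rewrite (arcE lt_a lt_b) imsetU1 imset_set1 -(fP (Ordinal lt_a) (Ordinal lt_b)) //.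
exact: partner_arc.
Qed.

(** The arcs of the patterns, with endpoints counted from 0. *)
Definition seq_P3 := [:: (0, 1); (2, 4); (3, 5); (6, 7)].
Definition seq_P4 := [:: (0, 1); (2, 4); (3, 6); (5, 7)].
Definition seq_P5 := [:: (0, 2); (1, 4); (3, 5); (6, 7)].

(** A concrete form of containment for patterns with 4 arcs: s lists the 8 endpoints
of the occurrence from left to right. *)
Definition occurs n (M : arcs n) (l : seq (nat * nat)) : Prop :=
  exists s : seq 'I_(2 * n),
     [/\ size s = 8, sorted (fun i j : 'I_(2 * n) => i < j) s &
      forall x0 i j, (i, j) \in l -> partner M (nth x0 s i) = nth x0 s j].

Lemma contains4P n (M : arcs n) (P : arcs 4) (l : seq (nat * nat)) :
  matching M -> matching P ->
  all (fun p => p.1 < p.2 < 8) l ->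
  P = [set B in [seq Defs.arc 4 p.1.+1 p.2.+1 | p <- l]] ->
  reflect (occurs M l) (contains M P).
Proof.
move=> mM mP lP PE.
have PE' B : (B \in P) = (B \in [seq Defs.arc 4 p.1.+1 p.2.+1 | p <- l]).
  by rewrite PE inE.
apply: (iffP (contains_arcsP mM mP lP PE')).
  case=> f [f_incr fP]; pose i0 : 'I_(2 * 4) := Ordinal (isT : 0 < 2 * 4).
  have insubE k : k < 8 -> insubd i0 k = k :> nat by move=> lt_k; rewrite val_insubd lt_k.
  exists (mkseq (fun k => f (insubd i0 k)) 8); split.
  - by rewrite size_mkseq.
  - by rewrite /= !f_incr // !insubE.
  - move=> x0 i j ijl; have /= /andP[lt_ij lt_j] := allP lP _ ijl.
    have lt_i := ltn_trans lt_ij lt_j.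
    by rewrite !nth_mkseq //; apply: fP; rewrite /= !insubE.
case=> s [size_s sort_s sP].
have x0 : 'I_(2 * n) by case: s size_s {sort_s sP} => // x.
have ltr : transitive (fun i j : 'I_(2 * n) => i < j) by move=> ? ? ?; apply: ltn_trans.
exists (fun i : 'I_(2 * 4) => nth x0 s i); split=> [i j lt_ij|i j ijl]; last exact: sP.
by apply: (sorted_ltn_nth ltr) => //; rewrite inE size_s; apply: ltn_ord.
Qed.

Lemma set4E (T : finType) (a b c d : T) : [set a; b; c; d] = [set x in [:: a; b; c; d]].
Proof. by apply/setP => x; rewrite !inE !orbA. Qed.

Lemma contains_P3P n (M : arcs n) :
  matching M -> reflect (occurs M seq_P3) (contains M P3).
Proof. by move=> mM; exact: (contains4P (l := seq_P3) mM P3_matching isT (set4E _ _ _ _)). Qed.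

Lemma contains_P4P n (M : arcs n) :
  matching M -> reflect (occurs M seq_P4) (contains M P4).
Proof. by move=> mM; exact: (contains4P (l := seq_P4) mM P4_matching isT (set4E _ _ _ _)). Qed.

Lemma contains_P5P n (M : arcs n) :
  matching M -> reflect (occurs M seq_P5) (contains M P5).
Proof. by move=> mM; exact: (contains4P (l := seq_P5) mM P5_matching isT (set4E _ _ _ _)). Qed.

(** * Avoidance of the patterns and short inner arcs *)

Definition tame n (M : arcs n) : Prop :=
  forall x, opener M x -> ~~ outer M x -> partner M x = x.+1 :> nat.

Section Patterns.
Variables (n : nat) (M : arcs n).
Hypothesis stM : stoimenow M.
Local Notation g := (partner M).

(** For an arc [p, q] that is not outer with q > p + 1, the position x = p + 1 is
decisive. As [p, q] is not outer, there are a closer y0 < p and an opener z0 > q.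
If x is a closer with opener u, then u < p; when u is not early, a closer before u
gives P3, and when u is early, the arc of the first closer gives P5. If x is an
opener, its arc ends after q by the Stoimenow condition; when its closer is not late,
a later opener gives P3, and when it is late, the arc of the last opener gives P4. *)
Lemma avoiding_tame :
  ~ occurs M seq_P3 -> ~ occurs M seq_P4 -> ~ occurs M seq_P5 -> tame M.
Proof.
have mM := stoimenow_matching stM.
move=> no3 no4 no5 p op; rewrite /outer op negb_or => /andP[ep lq].
have [//|neq_q] := eqVneq (g p : nat) p.+1.
have gK := partnerK mM.
have lt_pq : p < g p by [].
have [y0 le_yp cy0] := earlyPn ep.
have [z0 le_qz oz0] := latePn lq.
have neqyp : y0 != p by apply: contraNneq cy0 => ->.
have neqzq : z0 != g p by apply: contraTneq oz0 => ->; rewrite opener_partner // op.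
have lt_yp : y0 < p by rewrite ltn_neqAle neqyp.
have lt_qz : g p < z0 by rewrite ltn_neqAle eq_sym neqzq.
have gz0 : z0 < g z0 by [].
have lt_x : p.+1 < 2 * n by move: lt_pq neq_q (ltn_ord (g p)); clear; lia.
have [x xE] : exists x : 'I_(2 * n), x = p.+1 :> nat by exists (Ordinal lt_x).
have lt_xq : x < g p by rewrite xE ltn_neqAle eq_sym neq_q.
have [ox|cx] := boolP (opener M x).
  have lt_gg : g p < g x := opener_incr stM xE op ox.
  have gy0 : g y0 < y0 by rewrite -openerF.
  have [lw|/latePn[z' le_wz oz']] := boolP (late M (g x)).
    have [z oz z_max] : exists2 z, opener M z & forall t, opener M t -> t <= z.
      by case: (arg_maxnP (fun z : 'I_(2 * n) => z : nat) oz0) => z; exists z.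
    have lt_zw : z < g x.
      by rewrite ltnNge; apply/negP => /late_ge/(_ lw)/late_closer; rewrite oz.
    have lt_qz' : g p < z by apply: leq_trans (z_max _ oz0).
    have late_gz : late M (g z).
      apply/forallP => t; apply/implyP => le_t; apply/negP => /z_max.
      by apply/negP; rewrite -ltnNge (leq_trans _ le_t).
    have lt_wz : g x < g z.
      rewrite ltnNge leq_eqVlt negb_or; apply/andP; split.
        rewrite val_eqE (inj_eq (inv_inj gK)); apply/eqP => eq_zx.
        by move: lt_qz'; rewrite eq_zx ltnNge ltnW.
      by apply/negP => /(late_incr stM late_gz); rewrite !gK xE ltnS leqNgt (ltn_trans lt_pq).
    case: no4.
    exists [:: g y0; y0; p; x; g p; z; g x; g z]; split=> //.
      by rewrite /= gy0 lt_yp lt_qz' lt_zw lt_wz lt_xq xE leqnn.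
    move=> x0 i j; rewrite !inE.
    by case/or4P => /eqP[-> ->] /=; rewrite ?gK.
  have neqzw : z' != g x by apply: contraTneq oz' => ->; rewrite opener_partner // ox.
  have lt_wz : g x < z' by rewrite ltn_neqAle eq_sym neqzw.
  case: no3.
  exists [:: g y0; y0; p; x; g p; g x; z'; g z']; split=> //.
    by rewrite /= gy0 lt_yp lt_xq xE leqnn lt_gg lt_wz andbT; exact: oz'.
  move=> x0 i j; rewrite !inE.
  by case/or4P => /eqP[-> ->] /=; rewrite ?gK.
have lt_ux : g x < x by rewrite -openerF.
have lt_up : g x < p.
  rewrite ltn_neqAle -ltnS -xE lt_ux andbT val_eqE.
  by apply: contraTneq lt_xq => <-; rewrite gK ltnn.
have [eu|/earlyPn[y le_yu cy]] := boolP (early M (g x)); last first.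
  have neqyu : y != g x.
    by apply: contraNneq cy => ->; rewrite opener_partner.
  have lt_yu : y < g x by rewrite ltn_neqAle neqyu.
  case: no3.
  exists [:: g y; y; g x; p; x; g p; z0; g z0]; split=> //.
    rewrite openerF // in cy.
    by rewrite /= cy lt_yu lt_up lt_xq xE leqnn lt_qz gz0.
  move=> x0 i j; rewrite !inE.
  by case/or4P => /eqP[-> ->] /=; rewrite ?gK.
have [y cy y_min] : exists2 y, ~~ opener M y & forall t, ~~ opener M t -> y <= t.
  by case: (@arg_minnP _ y0 (fun y => ~~ opener M y) val cy0) => y; exists y.
have lt_yp' : y < p by apply: leq_ltn_trans (y_min _ cy0) lt_yp.
have gy : g y < y by rewrite -openerF.
have early_gy : early M (g y).
  apply/forallP => t; apply/implyP => le_t; apply/negPn/negP => /y_min.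
  by apply/negP; rewrite -ltnNge (leq_ltn_trans le_t).
have lt_uy : g x < y.
  by rewrite ltnNge; apply/negP => /early_le/(_ eu)/early_opener; apply/negP.
have lt_vu : g y < g x.
  rewrite ltnNge leq_eqVlt negb_or; apply/andP; split.
    rewrite val_eqE (inj_eq (inv_inj gK)); apply/eqP => eq_zx.
    by move: lt_yp'; rewrite -eq_zx xE ltnNge ltnW.
  by apply/negP => /(early_incr stM early_gy); rewrite !gK xE => /ltnW; rewrite ltnNge ltnW.
case: no5.
exists [:: g y; g x; y; p; x; g p; z0; g z0]; split=> //.
  by rewrite /= lt_vu lt_uy lt_yp' lt_xq xE leqnn lt_qz gz0.
move=> x0 i j; rewrite !inE.
by case/or4P => /eqP[-> ->] /=; rewrite ?gK.
Qed.

(** An arc with one arc entirely to its left and another entirely to its right is not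
outer. *)
Lemma tame_short (a p z : 'I_(2 * n)) : tame M ->
  a < g a -> g a < p -> p < g p -> g p < z -> z < g z -> g p = p.+1 :> nat.
Proof.
have mM := stoimenow_matching stM.
move=> tM oa lt_p op lt_z oz; apply: tM; rewrite // /outer /opener op.
rewrite negb_or; apply/andP; split; apply/negP.
  by move/(early_le (ltnW lt_p))/early_opener; rewrite opener_partner // /opener oa.
by move/(late_ge (ltnW lt_z))/late_closer; rewrite /opener oz.
Qed.

(** In each pattern some arc of length at least 2 lies between two others: the second
arc of P3 and of P4, the third arc of P5. *)
Lemma tame_avoiding : tame M ->
  [/\ ~ occurs M seq_P3, ~ occurs M seq_P4 & ~ occurs M seq_P5].
Proof.
move=> tM; have short := fun a p z => @tame_short a p z tM; split.
- case=> s [+ + sP].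
  case: s sP => [|x1 [|x2 [|x3 [|x4 [|x5 [|x6 [|x7 [|x8 [|? ?]]]]]]]]] // sP _ /=.
  case/and5P=> l1 l2 l3 l4 /and4P[l5 l6 l7 _].
  have /= g1 := sP x1 0 1 isT; have /= g3 := sP x1 2 4 isT.
  have /= g7 := sP x1 6 7 isT.
  have := @short x1 x3 x7; rewrite g1 g3 g7; lia.
- case=> s [+ + sP].
  case: s sP => [|x1 [|x2 [|x3 [|x4 [|x5 [|x6 [|x7 [|x8 [|? ?]]]]]]]]] // sP _ /=.
  case/and5P=> l1 l2 l3 l4 /and4P[l5 l6 l7 _].
  have /= g1 := sP x1 0 1 isT; have /= g3 := sP x1 2 4 isT.
  have /= g7 := sP x1 5 7 isT.
  have := @short x1 x3 x6; rewrite g1 g3 g7; lia.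
- case=> s [+ + sP].
  case: s sP => [|x1 [|x2 [|x3 [|x4 [|x5 [|x6 [|x7 [|x8 [|? ?]]]]]]]]] // sP _ /=.
  case/and5P=> l1 l2 l3 l4 /and4P[l5 l6 l7 _].
  have /= g1 := sP x1 0 2 isT; have /= g3 := sP x1 3 5 isT.
  have /= g7 := sP x1 6 7 isT.
  have := @short x1 x4 x7; rewrite g1 g3 g7; lia.
Qed.
End Patterns.

(** * Labels of positions *)

(** The components say whether the position is an opener, and whether its arc is
outer. *)
Notation label := (bool * bool)%type.
Notation outO := (true, true).
Notation outC := (false, true).
Notation inO := (true, false).
Notation inC := (false, false).

(** The labels that may follow a given one. An inner arc joins neighbours, which
explains the row of [inO] and the absence of [inC] elsewhere; the openers and closers
next to an inner arc are restricted by the Stoimenow condition. *)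
Definition label_succ (l : label) : seq label :=
  match l with
  | outO => [:: outO; outC]
  | outC => [:: outO; outC; inO]
  | inO => [:: inC]
  | inC => [:: outO; inO]
  end.

Definition step (l l' : label) : bool := l' \in label_succ l.

Lemma card_itv_le N (A : {set 'I_N}) i k :
  (forall x, x \in A -> i <= x < i + k) -> #|A| <= k.
Proof.
move=> AP; rewrite cardE -(size_map val) -(size_iota i k); apply: uniq_leq_size.
  by rewrite (map_inj_uniq val_inj) enum_uniq.
by move=> ? /mapP[x xA ->]; rewrite mem_iota; apply: AP; rewrite -mem_enum.
Qed.

Section Uniqueness.
Variables (n : nat) (M M' : arcs n).
Hypotheses (stM : stoimenow M) (stM' : stoimenow M').
Hypothesis eq_opener : opener M =1 opener M'.
Hypothesis eq_outer : outer M =1 outer M'.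
Local Notation g := (partner M).
Local Notation g' := (partner M').

(** At the first x where the two matchings disagree, a smaller partner in M would have
its partner in M' to the right of x, so that an outer arc of M' would be nested. *)
Lemma outer_partner_le (x : 'I_(2 * n)) :
    (forall y : 'I_(2 * n), y < x -> g y = g' y) ->
  opener M x -> outer M x -> g' x <= g x.
Proof.
have mM := stoimenow_matching stM; have mM' := stoimenow_matching stM'.
move=> IH ox outx; rewrite leqNgt; apply/negP => lt_g.
pose y := g' (g x).
have y_op : opener M' y.
  by rewrite /y opener_partner // -eq_opener opener_partner // ox.
have y_out : outer M' y by rewrite /y outer_partner // -eq_outer outer_partner.
have g'y : g' y = g x by rewrite partnerK.
have [lt_yx|lt_xy|eq_yx] := ltngtP y x.
- have := IH _ lt_yx; rewrite g'y => /(inv_inj (partnerK mM)) eq_yx.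
  by rewrite eq_yx ltnn in lt_yx.
- by move: y_out; apply/negP/(nested_inner stM' y_op lt_xy); rewrite g'y.
- by move: lt_g; rewrite -g'y (val_inj eq_yx) ltnn.
Qed.
End Uniqueness.

(** The partners are compared from left to right: a closer is settled by its opener, an
inner arc is short, and for an outer opener each of the two partners is at most the
other. *)
Lemma eq_labels n (M M' : arcs n) :
  stoimenow M -> tame M -> stoimenow M' -> tame M' ->
  opener M =1 opener M' -> outer M =1 outer M' -> M = M'.
Proof.
move=> stM tM stM' tM' eq_op eq_out.
have mM := stoimenow_matching stM; have mM' := stoimenow_matching stM'.
apply: eq_matching => // x; have [k] := ubnP (x : nat).
elim: k x => // k IHk x le_xk.
have IH (y : 'I_(2 * n)) : y < x -> partner M y = partner M' y.
  by move=> lt_yx; apply: IHk; apply: leq_trans lt_yx _.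
have [ox|] := boolP (opener M x); last first.
  rewrite openerF // => /IH; rewrite partnerK // => xE.
  by rewrite {2}xE partnerK.
have [outx|inx] := boolP (outer M x); last first.
  by apply: val_inj; rewrite /= tM // tM' // -?eq_op -?eq_out.
apply: val_inj; apply/eqP; rewrite /= eqn_leq !outer_partner_le //.
all: by rewrite -?eq_op -?eq_out // => y /IH.
Qed.

Section Labels.
Variables (n : nat) (M : arcs n).
Hypotheses (stM : stoimenow M) (tM : tame M).
Let mM := stoimenow_matching stM.
Local Notation g := (partner M).
Implicit Types x y : 'I_(2 * n).

Definition label_of x : label := (opener M x, outer M x).
Definition labels := [seq label_of x | x <- enum 'I_(2 * n)].

Lemma size_labels : size labels = 2 * n.
Proof. by rewrite size_map size_enum_ord. Qed.

Lemma nth_labels l x : nth l labels x = label_of x.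
Proof. by rewrite (nth_map x) ?size_enum_ord // nth_ord_enum. Qed.

Lemma inner_partner x : ~~ outer M x ->
  if opener M x then g x = x.+1 :> nat else (g x).+1 = x :> nat.
Proof.
move=> inx; case: ifP => [ox|/negbT cx]; first exact: tM.
by rewrite -tM ?partnerK ?opener_partner ?outer_partner.
Qed.

(** A first opener is early, and the first position cannot be a closer. *)
Lemma outer0 x : x = 0 :> nat -> outer M x.
Proof.
move=> x0; rewrite /outer ifT.
  apply/orP; left; apply/forallP => y; apply/implyP; rewrite x0 leqn0 => /eqP y0.
  rewrite (_ : y = x) ?x0; last by apply: val_inj; rewrite /= y0 x0.
  by rewrite -[opener _ _]negbK openerF // x0.
by rewrite -[opener _ _]negbK openerF // x0.
Qed.

Lemma outer_last x : x.+1 = 2 * n -> outer M x.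
Proof.
move=> xN; have ltg := ltn_ord (g x).
have cx : ~~ opener M x.
  by rewrite openerF //; have := partner_neq mM x; rewrite -val_eqE /=; lia.
rewrite /outer ifN //; apply/orP; right; apply/forallP => y; apply/implyP => le_xy.
rewrite (_ : y = x) //; apply: val_inj => /=; have := ltn_ord y; lia.
Qed.

(** An inner arc occupies two neighbouring positions. If an outer opener were followed
by an inner arc, the outer arc would contain it, and the two openers would violate the
Stoimenow condition; an inner arc followed by an outer closer is the mirror image. *)
Lemma step_label x x' : x' = x.+1 :> nat -> step (label_of x) (label_of x').
Proof.
move=> x'E; rewrite /step /label_of.
have gK := partnerK mM.
have op_g y : opener M (g y) = ~~ opener M y by apply: opener_partner.
have out_g y : outer M (g y) = outer M y by apply: outer_partner.
have innerC : ~~ opener M x' -> ~~ outer M x' -> opener M x /\ ~~ outer M x.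
  move=> cx' inx'; have := inner_partner inx'; rewrite (negPf cx') => gx'.
  have <- : g x' = x by apply: val_inj => /=; lia.
  by rewrite op_g out_g.
have innerO : opener M x -> ~~ outer M x -> ~~ opener M x' /\ ~~ outer M x'.
  move=> ox inx; have := inner_partner inx; rewrite ox => gx.
  have <- : g x = x' by apply: val_inj; rewrite /= gx x'E.
  by rewrite op_g out_g ox.
have outOO : opener M x -> outer M x -> opener M x' -> outer M x'.
  move=> ox outx ox'; apply/negPn/negP => inx'.
  have := inner_partner inx'; rewrite ox' => gx'.
  have := opener_incr stM x'E ox ox'.
  have : g x != x' by apply: contraTneq ox' => <-; rewrite op_g ox.
  move: ox; rewrite /opener -val_eqE /=; move: gx' x'E; clear; lia.
have inCC : ~~ opener M x -> ~~ outer M x -> opener M x'.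
  move=> cx inx; apply/negPn/negP => cx'.
  have := inner_partner inx; rewrite (negPf cx) => gx.
  have := closer_incr stM x'E cx cx'.
  have : g x' != x by apply: contraNneq cx => <-; rewrite op_g.
  move: cx'; rewrite openerF // -val_eqE /=; move: gx x'E; clear; lia.
case: (opener M x) (outer M x) (opener M x') (outer M x') innerC innerO outOO inCC
  => [] [] [] [] // h1 h2 h3 h4.
all: by [ case: (h1 isT isT) | case: (h2 isT isT) | have := h3 isT isT isT | have := h4 isT isT].
Qed.
End Labels.

(** The defaults of [head] and [last] are chosen so that both conditions hold for an
empty u. *)
Lemma trim_word (T : eqType) (a b : T) (s : seq T) : a != b ->
  exists i u j, [/\ s = nseq i a ++ u ++ nseq j b, head b u != a & last a u != b].
Proof.
move=> neq_ab.
have [i [t -> head_t]] : exists i, exists2 t, s = nseq i a ++ t & head b t != a.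
  elim: s => [|x s [i [t -> head_t]]]; first by exists 0, [::]; rewrite //= eq_sym.
  by have [->|neq_x] := eqVneq x a; [exists i.+1, t | exists 0, (x :: nseq i a ++ t)].
have [u [j t_u last_u]] : exists u, exists2 j, t = u ++ nseq j b & last a u != b.
  elim/last_ind: t {head_t} => [|t x [u [j -> last_u]]]; first by exists [::], 0.
  have [->|neq_x] := eqVneq x b; last first.
    by exists (rcons (u ++ nseq j b) x), 0; rewrite ?cats0 ?last_rcons.
  by exists u, j.+1; rewrite // -addn1 nseqD catA cats1.
exists i, u, j; split; rewrite ?t_u //.
by move: head_t; rewrite t_u; case: (u) => //= _; rewrite eq_sym.
Qed.

Definition block_word i u j : seq label := nseq i outO ++ u ++ nseq j outC.

(** The outer labels at both ends of the word serve as sentinels for the local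
condition, which thereby also constrains the first and the last label. *)
Record balanced i u j : Prop := Balanced {
  balanced_path : path step outO (rcons (block_word i u j) outC);
  balanced_count : count_mem outO (block_word i u j) = count_mem outC (block_word i u j);
  balanced_le : count_mem outC u <= i }.

Section WordOfMatching.
Variables (n : nat) (M : arcs n).
Hypotheses (stM : stoimenow M) (tM : tame M).
Let mM := stoimenow_matching stM.
Local Notation g := (partner M).
Implicit Types x y : 'I_(2 * n).

(** Position 0 and the last position have outer arcs, which is what the sentinels
require. *)
Lemma path_labels : path step outO (rcons (labels M) outC).
Proof.
apply/(pathP outC) => i; rewrite size_rcons size_labels ltnS leq_eqVlt => /predU1P[->|lt_i].
  rewrite nth_rcons size_labels ltnn eqxx.
  case: (posnP (2 * n)) => [->//|N_gt0].
  have lt1 : (2 * n).-1 < 2 * n by rewrite prednK.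
  rewrite -{1}(prednK N_gt0) /= nth_rcons size_labels lt1.
  rewrite (nth_labels M outC (Ordinal lt1)) /label_of.
  by rewrite outer_last //= ?prednK //; case: opener.
rewrite nth_rcons size_labels lt_i (nth_labels M outC (Ordinal lt_i)).
case: i lt_i => [|i] lt_i /=.
  by rewrite /label_of outer0 //; case: opener.
rewrite nth_rcons size_labels (ltnW lt_i) (nth_labels M outC (Ordinal (ltnW lt_i))).
exact: step_label.
Qed.

Lemma count_labels (p : pred label) : count p (labels M) = #|[set x | p (label_of M x)]|.
Proof.
by rewrite count_map enumT cardsE cardE /enum_mem size_filter; apply: eq_count.
Qed.

Lemma count_outer : count_mem outO (labels M) = count_mem outC (labels M).
Proof.
rewrite !count_labels -(card_imset _ (inv_inj (partnerK mM))); congr #|pred_of_set _|.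
apply/setP => x; rewrite -{1}[x](partnerK mM) mem_imset; last exact: inv_inj (partnerK mM).
by rewrite !inE /label_of opener_partner // outer_partner //= !xpair_eqE; case: opener.
Qed.

(** The maximal blocks O^i at the start and C^j at the end contain all early openers
and all late closers. Every outer closer is late or has an early partner, so there
are at most i + j of them, and j of them lie in the last block. *)
Lemma labels_balanced : exists i u j,
  [/\ labels M = block_word i u j, head outC u != outO, last outO u != outC
    & balanced i u j].
Proof.
have [i [u [j [Tiuj head_u last_u]]]] := trim_word (labels M) (isT : outO != outC).
exists i, u, j; split=> //; split; rewrite /block_word -?Tiuj.
- exact: path_labels.
- exact: count_outer.
have sizeT := size_labels M; rewrite Tiuj !size_cat !size_nseq in sizeT.
have early_lt x : early M x -> x < i.
  move=> ex; rewrite ltnNge; apply/negP => le_ix.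
  have lt_i := leq_ltn_trans le_ix (ltn_ord x).
  have ei : early M (Ordinal lt_i) by apply: early_le ex.
  have := nth_labels M outC (Ordinal lt_i).
  rewrite Tiuj nth_cat size_nseq ltnn subnn /label_of /outer early_opener // ei /=.
  move: head_u; case: (u) => [|l u'] /=; first by case: (j).
  by move=> /eqP.
have late_ge_u x : late M x -> i + size u <= x.
  move=> lx; rewrite leqNgt; apply/negP => lt_x.
  have gt0 : 0 < i + size u by apply: leq_ltn_trans lt_x.
  have lt_k : (i + size u).-1 < 2 * n by rewrite prednK // -[leqRHS]sizeT addnA leq_addr.
  have lk : late M (Ordinal lt_k) by apply: late_ge lx; rewrite /= -ltnS prednK.
  have := nth_labels M outO (Ordinal lt_k).
  rewrite Tiuj catA nth_cat size_cat size_nseq /= prednK // leqnn.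
  rewrite /label_of /outer (negPf (late_closer lk)) lk orbT.
  case/lastP: (u) last_u gt0 => [_|u' l] /=.
    by rewrite cats0 nth_nseq; case: ifP.
  rewrite last_rcons size_rcons addnS nth_cat size_nseq /= => /eqP neq_l _.
  by rewrite ltnNge leq_addr /= addKn nth_rcons ltnn eqxx.
rewrite -(leq_add2r j).
have <- : count_mem outC (labels M) = count_mem outC u + j.
  by rewrite Tiuj !count_cat !count_nseq /= mul0n mul1n.
rewrite count_labels.
apply: leq_trans (_ : #|g @: [set x | early M x] :|: [set x | late M x]| <= _).
  apply/subset_leq_card/subsetP => x; rewrite !inE xpair_eqE /outer eqbF_neg eqb_id.
  case: (opener M x) => //= /orP[ex|->]; last by rewrite orbT.
  by rewrite -[x](partnerK mM) imset_f ?inE.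
apply: leq_trans (leq_card_setU _ _) _; apply: leq_add.
  rewrite card_imset; last exact: inv_inj (partnerK mM).
  by apply: (@card_itv_le _ _ 0) => x; rewrite inE => /early_lt.
apply: (@card_itv_le _ _ (i + size u)) => x; rewrite inE => /late_ge_u ->.
by rewrite /= -addnA sizeT ltn_ord.
Qed.
End WordOfMatching.

(** * The matching of a balanced label word *)

Section Realization.
Variables (n i j : nat) (u : seq label).
Hypotheses (balT : balanced i u j) (sizeT : size (block_word i u j) = 2 * n).

Let lab p := nth outC (block_word i u j) p.

Definition positions l := [seq p <- iota 0 (2 * n) | lab p == l].

(** The k-th [outO] is matched with the k-th [outC], and [inO] with its right
neighbour. *)
Definition mate p :=
  match lab p with
  | outO => nth 0 (positions outC) (index p (positions outO))
  | outC => nth 0 (positions outO) (index p (positions outC))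
  | inO => p.+1
  | inC => p.-1
  end.

Lemma size_block : i + (size u + j) = 2 * n.
Proof. by rewrite -sizeT !size_cat !size_nseq. Qed.

Lemma mem_positions l p : (p \in positions l) = (p < 2 * n) && (lab p == l).
Proof. by rewrite mem_filter mem_iota andbC. Qed.

Lemma size_positions l : size (positions l) = count_mem l (block_word i u j).
Proof.
rewrite size_filter -[in RHS](mkseq_nth outC (block_word i u j)) sizeT.
by rewrite count_map.
Qed.

Lemma positions_uniq l : uniq (positions l).
Proof. exact: filter_uniq (iota_uniq _ _). Qed.

Lemma positions_sorted l : sorted ltn (positions l).
Proof. exact: (sorted_filter ltn_trans _ (iota_ltn_sorted _ _)). Qed.

Lemma lab_left p : p < i -> lab p = outO.
Proof. by move=> lt_p; rewrite /lab nth_cat size_nseq lt_p nth_nseq lt_p. Qed.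

Lemma lab_right p : i + size u <= p -> lab p = outC.
Proof.
move=> le_p; rewrite /lab nth_cat size_nseq ltnNge (leq_trans (leq_addr _ _) le_p) /=.
rewrite nth_cat ltnNge leq_subRL ?le_p ?nth_nseq ?if_same //.
exact: leq_trans (leq_addr _ _) le_p.
Qed.

Lemma step_lab p : p < 2 * n -> step (lab p) (lab p.+1).
Proof.
move=> lt_p; have /pathP := balanced_path balT => /(_ outC p.+1).
rewrite size_rcons sizeT ltnS => /(_ lt_p) /=.
rewrite !nth_rcons sizeT lt_p; case: ltnP => // le_N.
by rewrite if_same /lab (nth_default _ (n := p.+1)) ?sizeT.
Qed.

Lemma lab_inO p : p < 2 * n -> lab p = inO -> p.+1 < 2 * n /\ lab p.+1 = inC.
Proof.
move=> lt_p pO; have := step_lab lt_p; rewrite pO /step inE => /eqP pC; split=> //.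
by rewrite ltnNge; apply/negP => le_N; rewrite /lab nth_default ?sizeT in pC.
Qed.

Lemma lab_inC p : p < 2 * n -> lab p = inC -> 0 < p /\ lab p.-1 = inO.
Proof.
move=> lt_p pC; have /pathP := balanced_path balT => /(_ outC p).
rewrite size_rcons sizeT ltnS (ltnW lt_p) nth_rcons sizeT lt_p -/(lab p) pC => /(_ isT).
case: p lt_p {pC} => [//|p] lt_p /=; rewrite nth_rcons sizeT (ltnW lt_p) -/(lab p).
by case: (lab p) => -[] [].
Qed.

Lemma size_positions_eq : size (positions outO) = size (positions outC).
Proof. by rewrite !size_positions balanced_count. Qed.

(** This lemma and the next keep the rank, so that the two cases of [mate] undo each
other. *)
Lemma mate_outO p : p < 2 * n -> lab p = outO ->
  [/\ mate p \in positions outC, index (mate p) (positions outC) = index p (positions outO)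
    & nth 0 (positions outO) (index p (positions outO)) = p].
Proof.
move=> lt_p pO; have pP : p \in positions outO by rewrite mem_positions lt_p pO.
have lt_ix : index p (positions outO) < size (positions outC).
  by rewrite -size_positions_eq index_mem.
rewrite /mate pO; split; [exact: mem_nth | exact: (index_uniq _ _ (positions_uniq _)) |].
exact: nth_index.
Qed.

Lemma mate_outC p : p < 2 * n -> lab p = outC ->
  [/\ mate p \in positions outO, index (mate p) (positions outO) = index p (positions outC)
    & nth 0 (positions outC) (index p (positions outC)) = p].
Proof.
move=> lt_p pO; have pP : p \in positions outC by rewrite mem_positions lt_p pO.
have lt_ix : index p (positions outC) < size (positions outO).
  by rewrite size_positions_eq index_mem.
rewrite /mate pO; split; [exact: mem_nth | exact: (index_uniq _ _ (positions_uniq _)) |].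
exact: nth_index.
Qed.

Lemma mateP p : p < 2 * n ->
  [/\ mate p < 2 * n, mate (mate p) = p & lab (mate p) = (~~ (lab p).1, (lab p).2)].
Proof.
move=> lt_p; case pE: (lab p) => [[] []] /=.
- have [] := mate_outO lt_p pE; rewrite mem_positions => /andP[lt_m /eqP mC] ix nthK.
  by split=> //; rewrite {1}/mate mC ix.
- have [lt_p1 p1C] := lab_inO lt_p pE.
  by rewrite {1 3 4}/mate pE; split=> //; rewrite /mate p1C.
- have [] := mate_outC lt_p pE; rewrite mem_positions => /andP[lt_m /eqP mC] ix nthK.
  by split=> //; rewrite {1}/mate mC ix.
- have [p_gt0 p1O] := lab_inC lt_p pE.
  rewrite {1 3 4}/mate pE; split=> //; first by rewrite prednK // ltnW.
  by rewrite /mate p1O prednK.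
Qed.

Lemma positions_outO : exists s, positions outO = iota 0 i ++ s.
Proof.
rewrite /positions -size_block iotaD filter_cat.
have /all_filterP -> : all (fun p => lab p == outO) (iota 0 i).
  by apply/allP => p; rewrite mem_iota => /lab_left ->.
by eexists.
Qed.

Lemma positions_outC :
  exists2 s, positions outC = s ++ iota (i + size u) j & size s <= i.
Proof.
exists [seq p <- iota 0 (i + size u) | lab p == outC].
  rewrite /positions -size_block addnA iotaD filter_cat; congr (_ ++ _).
  apply/all_filterP/allP => p; rewrite mem_iota => /andP[le_p _].
  by rewrite lab_right.
have := size_positions outC.
rewrite {1}/positions -size_block addnA iotaD filter_cat size_cat.
have /all_filterP -> : all (fun p => lab p == outC) (iota (0 + (i + size u)) j).
  by apply/allP => p; rewrite mem_iota => /andP[/lab_right -> _].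
rewrite size_iota /block_word !count_cat !count_nseq /= mul0n mul1n add0n.
by move=> /addIn ->; exact: balanced_le balT.
Qed.

(** If p is the k-th outer opener, counted from 0, then k < i forces p to be in the first block, while
k >= i is at least the number of [outC] in u, so that the k-th [outC] is in the last
block. *)
Lemma mate_outer p : p < 2 * n -> lab p = outO ->
  p < i <= mate p \/ p < i + size u <= mate p.
Proof.
move=> lt_p pO; have [] := mate_outO lt_p pO.
rewrite mem_positions => /andP[lt_m /eqP mC] ix nthK.
have [lt_k|le_k] := ltnP (index p (positions outO)) i.
  left; apply/andP; split.
    have [s sE] := positions_outO; rewrite sE in lt_k nthK.
    by rewrite -nthK nth_cat size_iota lt_k nth_iota.
  by rewrite leqNgt; apply/negP => /lab_left; rewrite mC.
right; apply/andP; split.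
  by rewrite ltnNge; apply/negP => /lab_right; rewrite pO.
rewrite /mate pO; have [s sE le_s] := positions_outC.
have lt_ix : index p (positions outO) < size (positions outC).
  by rewrite -size_positions_eq index_mem mem_positions lt_p pO.
rewrite sE nth_cat ltnNge (leq_trans le_s le_k) /= nth_iota ?leq_addr //.
by rewrite ltn_subLR ?(leq_trans le_s le_k) // -[j](size_iota (i + size u)) -size_cat -sE.
Qed.

Lemma lt_mate p : p < 2 * n -> (p < mate p) = (lab p).1.
Proof.
have ltO q : q < 2 * n -> lab q = outO -> q < mate q.
  move=> lt_q qO; have [] := mate_outer lt_q qO => /andP[]; exact: leq_trans.
move=> lt_p; case pE: (lab p) => [[] []] /=.
- exact: ltO.
- by rewrite /mate pE ltnSn.
- have [lt_m mK] := mateP lt_p; rewrite pE => /(ltO _ lt_m).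
  by rewrite mK => lt_mp; rewrite ltnNge ltnW.
- by rewrite /mate pE; case: p {lt_p pE} => //= p; rewrite ltnNge leqnSn.
Qed.

Definition mate_ord (x : 'I_(2 * n)) : 'I_(2 * n) := insubd x (mate x).

Lemma val_mate_ord (x : 'I_(2 * n)) : mate_ord x = mate x :> nat.
Proof. by rewrite val_insubd; case: (mateP (ltn_ord x)) => ->. Qed.

Lemma mate_ordK : involutive mate_ord.
Proof.
move=> x; apply: val_inj; rewrite /= !val_mate_ord.
by case: (mateP (ltn_ord x)).
Qed.

Lemma mate_ord_neq x : mate_ord x != x.
Proof.
apply/eqP => /(congr1 (@nat_of_ord _)); rewrite val_mate_ord => xE.
have [_ _] := mateP (ltn_ord x); rewrite xE.
by case: (lab x) => -[].
Qed.

Definition realization : arcs n := matching_of mate_ord.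
Let mM : matching realization := matching_ofP mate_ordK mate_ord_neq.

Lemma partner_realization (x : 'I_(2 * n)) : partner realization x = mate x :> nat.
Proof. by rewrite (partner_matching_of mate_ordK mate_ord_neq) val_mate_ord. Qed.

Lemma opener_realization (x : 'I_(2 * n)) : opener realization x = (lab x).1.
Proof. by rewrite /opener partner_realization lt_mate. Qed.

Lemma early_realization (x : 'I_(2 * n)) : x < i -> early realization x.
Proof.
move=> lt_x; apply/forallP => y; apply/implyP => le_y.
by rewrite opener_realization lab_left // (leq_ltn_trans le_y).
Qed.

Lemma late_realization (x : 'I_(2 * n)) : i + size u <= x -> late realization x.
Proof.
move=> le_x; apply/forallP => y; apply/implyP => le_y.
by rewrite opener_realization lab_right // (leq_trans le_x).
Qed.

(** The local condition puts a closer just before each [inO] and an opener just after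
each [inC], so a short arc labelled as inner is indeed not outer. *)
Lemma outer_opener_realization (x : 'I_(2 * n)) :
  opener realization x -> outer realization x = (lab x).2.
Proof.
move=> ox; rewrite /outer ox.
rewrite opener_realization in ox.
case xE: (lab x) ox => [[] []] //= _.
  have [/andP[/early_realization-> //]|/andP[_ le_m]] := mate_outer (ltn_ord x) xE.
  by rewrite late_realization ?orbT // partner_realization.
have [lt_x1 x1C] := lab_inO (ltn_ord x) xE.
apply/negbTE; rewrite negb_or; apply/andP; split; apply/negP.
  case: (posnP x) => [x0|x_gt0].
    have lt0 : 0 < 2 * n by rewrite -{1}x0.
    have /pathP := balanced_path balT => /(_ outC 0).
    rewrite size_rcons => /(_ isT); rewrite nth_rcons sizeT lt0 -/(lab 0).
    by move: xE; rewrite x0 => ->.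
  have lt_x0 : x.-1 < 2 * n by apply: leq_ltn_trans (ltn_ord x); apply: leq_pred.
  have := step_lab lt_x0; rewrite prednK // xE => sx.
  move/(@early_le _ _ _ (Ordinal lt_x0))=> /(_ (leq_pred _)) /early_opener.
  by rewrite opener_realization /=; case: (lab x.-1) sx => -[] [].
have lt_x2 : x.+2 < 2 * n.
  rewrite ltn_neqAle lt_x1 andbT; apply/eqP => x2.
  have := step_lab lt_x1; rewrite x1C /lab (nth_default _ (n := x.+2)) ?sizeT ?x2 //.
move/(@late_ge _ _ _ (Ordinal lt_x2)); rewrite partner_realization /mate xE.
move=> /(_ (leqnSn _)) /late_closer; rewrite opener_realization /=.
by have := step_lab lt_x1; rewrite x1C; case: (lab x.+2) => -[] [].
Qed.

Lemma labels_realization : labels realization = block_word i u j.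
Proof.
apply: (@eq_from_nth _ outC) => [|p]; rewrite size_labels ?sizeT // => lt_p.
rewrite (nth_labels _ outC (Ordinal lt_p)) /label_of -/(lab p).
set x := Ordinal lt_p; rewrite (_ : lab p = lab x) // [RHS]surjective_pairing.
congr pair; first exact: opener_realization.
have [ox|cx] := boolP (opener realization x); first exact: outer_opener_realization.
rewrite -outer_partner // outer_opener_realization ?opener_partner //.
by rewrite partner_realization; case: (mateP (ltn_ord x)) => _ _ ->.
Qed.

Lemma tame_realization : tame realization.
Proof.
move=> x ox; rewrite outer_opener_realization //.
move: ox; rewrite opener_realization partner_realization /mate.
by case: (lab x) => -[] [].
Qed.

Lemma mate_incr p q : p < q -> q < 2 * n -> lab p = lab q -> (lab p).2 -> mate p < mate q.
Proof.
move=> lt_pq lt_q eq_lab; have lt_p := ltn_trans lt_pq lt_q.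
have pP : p \in positions (lab p) by rewrite mem_positions lt_p eqxx.
have qP : q \in positions (lab p) by rewrite mem_positions lt_q eq_lab eqxx.
have ltix : index p (positions (lab p)) < index q (positions (lab p)).
  rewrite ltnNge leq_eqVlt; apply/negP => /predU1P[|lt_ix].
    move/(congr1 (nth 0 (positions (lab p)))); rewrite !nth_index // => q_p.
    by rewrite q_p ltnn in lt_pq.
  have := sorted_ltn_index ltn_trans (positions_sorted (lab p)) q p qP pP lt_ix.
  by rewrite /= ltnNge ltnW.
have nth_lt l k k' : k < k' -> k' < size (positions l) ->
    nth 0 (positions l) k < nth 0 (positions l) k'.
  move=> ltk ltk'; apply: (sorted_ltn_nth ltn_trans 0 (positions_sorted l)) => //.
  by rewrite inE; apply: ltn_trans ltk'.
rewrite -index_mem in qP; rewrite /mate -eq_lab; move: ltix qP.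
case: (lab p) => -[] [] //= ltix qP _; apply: nth_lt => //.
  by rewrite -size_positions_eq.
by rewrite size_positions_eq.
Qed.

(** The local condition leaves two neighbouring openers, or two neighbouring closers,
only if both are outer. *)
Lemma stoimenow_realization : stoimenow realization.
Proof.
have incr (x x' : 'I_(2 * n)) : x' = x.+1 :> nat -> (lab x).1 = (lab x').1 ->
    mate x < mate x'.
  move=> x'E; have lt_x' : x.+1 < 2 * n by rewrite -x'E.
  have := step_lab (ltn_ord x); have := @mate_incr x x.+1 (leqnn _) lt_x'.
  rewrite x'E; case: (lab x) (lab x.+1) => [[] []] [[] []] //.
  - by move=> mate_lt _ _; apply: mate_lt.
  - by move=> mate_lt _ _; apply: mate_lt.
apply/and3P; split => //; [apply/(type1P mM) | apply/(type2P mM)] => x x' x'E.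
  rewrite !opener_realization !partner_realization => ox ox'.
  by apply: incr; rewrite // ox ox'.
rewrite !opener_realization !partner_realization => cx cx'.
by apply: incr; rewrite // (negPf cx) (negPf cx').
Qed.
End Realization.

(** * Words and their automaton *)

(** The letters of a word stand for the arcs: [Closing] for an early arc whose closer
is not late, [Opening] for a late arc whose opener is not early, [Short] for an inner
arc, [Long] for an arc that is both early and late. The letters double as automaton
states, the state being the last letter read; [Start] is the initial state and never
occurs in a word. *)
Inductive letter := Start | Closing | Opening | Short | Long.

Definition nat_of_letter (l : letter) : nat :=
  match l with Start => 0 | Closing => 1 | Opening => 2 | Short => 3 | Long => 4 end.

Lemma nat_of_letter_inj : injective nat_of_letter. Proof. by do 2!case. Qed.

HB.instance Definition _ := Equality.copy letter (inj_type nat_of_letter_inj).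

Definition next (q : letter) : seq letter :=
  match q with
  | Start => [:: Closing; Long]
  | Closing => [:: Closing; Opening; Short]
  | Opening => [:: Closing; Opening; Long]
  | Short => [:: Opening; Short]
  | Long => [:: Long]
  end.
Definition trans (q l : letter) : bool := l \in next q.

(** The label that precedes the rest of the word in the middle block. Before the first
letter this is the last label of the initial block; the letter [Long] leaves no label
in the middle block and only comes after [Opening] or at the start. *)
Definition last_label (q : letter) : label :=
  match q with Closing => outC | Short => inC | _ => outO end.
Definition accepting (q : letter) : bool := last_label q == outO.

Fixpoint language (q : letter) (n : nat) : seq (seq letter) :=
  if n is n'.+1 then [seq l :: w | l <- next q, w <- language l n']
  else if accepting q then [:: [::]] else [::].

Lemma mem_language q n w :
  (w \in language q n) = [&& size w == n, path trans q w & accepting (last q w)].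
Proof.
elim: n q w => [|n IHn] q w.
  by case: w => [|l w] /=; case: ifP; rewrite ?inE ?in_nil.
apply/allpairsPdep/idP => [[l [v [ql vL ->]]]|].
  by move: vL; rewrite IHn /= eqSS => /and3P[-> -> ->]; rewrite /trans ql.
case: w => // l w /=; rewrite eqSS => /and3P[sz /andP[ql pth] acc].
by exists l, w; split; rewrite // IHn sz pth.
Qed.

Lemma language_uniq q n : uniq (language q n).
Proof.
elim: n q => [|n IHn] q /=; first by case: ifP.
apply: allpairs_uniq_dep => [|l _|[l w] [l' w'] _ _ /= [-> ->]] //; by case: q.
Qed.

Local Arguments language : simpl never.

Definition language_size n := size (language Start n).

Lemma size_languageS q n :
  size (language q n.+1) = sumn [seq size (language l n) | l <- next q].
Proof. exact: size_allpairs_dep. Qed.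

Lemma size_language_Long n : size (language Long n) = 1.
Proof. by elim: n => // n IHn; rewrite size_languageS /= IHn. Qed.

(** Unfolding the automaton expresses all four values through the numbers of words
accepted from each state, in which the recurrence becomes an identity. *)
Lemma language_size_recurrent : recurrent language_size.
Proof.
rewrite /recurrent /language_size => -[|n]; first by [].
have sz := (size_languageS Start, size_languageS Closing,
            size_languageS Opening, size_languageS Short, size_language_Long).
by rewrite !sz /= !sz /= !sz /= !sz /= !sz; lia.
Qed.

Definition letter_labels (l : letter) : seq label :=
  match l with
  | Closing => [:: outC] | Opening => [:: outO] | Short => [:: inO; inC] | _ => [::]
  end.
Definition middle (w : seq letter) : seq label := flatten (map letter_labels w).

(** Early and late arcs put their other endpoint into the initial and the final
block, and [Long] arcs put one endpoint into each. *)
Definition word_labels (w : seq letter) : seq label :=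
  nseq (count_mem Closing w + count_mem Long w) outO ++ middle w ++
  nseq (count_mem Opening w + count_mem Long w) outC.

Lemma path_notStart q w : path trans q w -> Start \notin w.
Proof.
elim: w q => //= l w IHw q /andP[ql /IHw]; rewrite inE negb_or => ->.
by case: q ql; case: l.
Qed.

Lemma size_word q w : path trans q w ->
  size w = count_mem Closing w + count_mem Opening w + count_mem Short w + count_mem Long w.
Proof.
move/path_notStart; elim: w => //= l w IHw; rewrite inE negb_or => /andP[+ /IHw ->].
by case: l => //= _; lia.
Qed.

Lemma size_middle w :
  size (middle w) = count_mem Closing w + count_mem Opening w + 2 * count_mem Short w.
Proof.
elim: w => //= l w IHw; rewrite /middle /= size_cat -/(middle w) IHw.
case: l => /=; lia.
Qed.

Lemma count_middle w :
  count_mem outC (middle w) = count_mem Closing w /\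
  count_mem outO (middle w) = count_mem Opening w.
Proof.
elim: w => //= l w [IHc IHo]; rewrite /middle /= !count_cat -/(middle w) IHc IHo.
by case: l.
Qed.

Lemma size_word_labels q w : path trans q w -> size (word_labels w) = 2 * size w.
Proof.
move/size_word => ->; rewrite !size_cat !size_nseq size_middle; lia.
Qed.

Lemma path_middle q w k : path trans q w -> accepting (last q w) ->
  path step (last_label q) (middle w ++ nseq k outC).
Proof.
elim: w q => [|l w IHw] q /=.
  by move=> _ /eqP ->; case: k => //= k; elim: k.
rewrite /middle /= -/(middle w) -catA => /andP[ql pth] acc.
by have := IHw l pth acc; case: q ql; case: l {pth acc}.
Qed.

Lemma path_nseq_outO k s : path step outO s -> path step outO (nseq k outO ++ s).
Proof. by move=> ps; elim: k. Qed.

Lemma path_word_labels n w : w \in language Start n ->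
  path step outO (rcons (word_labels w) outC).
Proof.
rewrite mem_language => /and3P[_ pth acc].
rewrite /word_labels -cats1 -!catA (cats1 (nseq _ _)); apply: path_nseq_outO.
have -> j : rcons (nseq j outC) outC = nseq j.+1 outC by rewrite -addn1 nseqD cats1.
exact: (path_middle _ pth acc).
Qed.

Lemma word_labels_count w :
  count_mem outO (word_labels w) = count_mem outC (word_labels w).
Proof.
have [cC cO] := count_middle w.
rewrite /word_labels !count_cat !count_nseq cC cO /=; lia.
Qed.

(** * Words correspond to balanced label words *)

(** From a rejecting state, an accepting one is reached only by reading [Opening]. *)
Lemma mem_outO_middle q w : path trans q w -> accepting (last q w) ->
  ~~ accepting q -> outO \in middle w.
Proof.
elim: w q => [|l w IHw] q /=; first by move=> _ ->.
rewrite /middle /= mem_cat -/(middle w) => /andP[ql pth] acc nq.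
by have := IHw l pth acc; case: l q ql nq {pth acc} => -[] //= _ _ ->; rewrite ?orbT.
Qed.

Lemma middle_Long w : path trans Long w -> middle w = [::].
Proof. by elim: w => //= l w IHw; case: l => // /IHw. Qed.

(** On the left only labels [outC] occur. A word that starts with another letter
contains a different label: at once, or, after [Closing], because it still has to reach
an accepting state. *)
Lemma middle_Long_neq q l v w k k' :
  path trans Long w -> l != Long -> path trans q (l :: v) -> accepting (last l v) ->
  middle w ++ nseq k outC <> middle (l :: v) ++ nseq k' outC.
Proof.
move=> /middle_Long -> neq_l /= /andP[ql pth] acc eq_s.
have onlyC x : x \in middle (l :: v) -> x = outC.
  move=> xm; have : x \in nseq k outC by rewrite [nseq _ _]eq_s mem_cat xm.
  by case/nseqP.
move: onlyC; rewrite /middle /=; have := mem_outO_middle pth acc.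
case: l neq_l ql {pth acc eq_s} => //=; first by case: q.
- by move=> _ _ /(_ isT) oO /(_ outO); rewrite inE oO => /(_ isT).
- by move=> _ _ _ /(_ outO); rewrite inE eqxx => /(_ isT).
- by move=> _ _ _ /(_ inO); rewrite inE eqxx => /(_ isT).
Qed.

(** Two different letters allowed in the same state produce labels that differ at
once, unless one of them is [Long]; after that letter there are only labels [outC], so
[middle_Long_neq] applies. The trailing blocks are part of the statement because the
middle blocks need not have the same length. *)
Lemma middle_inj q w v k k' :
  path trans q w -> accepting (last q w) -> path trans q v -> accepting (last q v) ->
  size w = size v -> middle w ++ nseq k outC = middle v ++ nseq k' outC -> w = v.
Proof.
elim: w v q => [|l w IHw] [|m v] q //= /andP[ql pw] accw /andP[qm pv] accv [eq_size].
move: qm pv accv; have [<-{m}|neq_lm] := eqVneq l m => qm pv accv.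
  rewrite /middle /= -!catA => /eqP; rewrite eqseq_cat // eqxx /= => /eqP /(IHw v l) -> //.
have [lL|nl] := eqVneq l Long.
  rewrite lL in pw neq_lm *; rewrite {1}/middle /= -/(middle w) => eq_s.
  by case: (@middle_Long_neq q m v w k k'); rewrite //= 1?eq_sym ?qm.
have [mL|nm] := eqVneq m Long.
  rewrite mL in pv neq_lm *; rewrite {2}/middle /= -/(middle v) => /esym eq_s.
  by case: (@middle_Long_neq q l w v k' k); rewrite //= ?ql.
by rewrite /middle /=; case: l m nl nm neq_lm {pw accw pv accv} ql qm => -[] // _ _ _; case: q.
Qed.

Lemma nseq_cat_inj (T : eqType) (a b : T) i j (s t : seq T) :
  head b s != a -> head b t != a -> nseq i a ++ s = nseq j a ++ t -> s = t.
Proof.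
move=> hs ht; elim: i j => [|i IHi] [|j] //=; last by case=> /IHi.
  by move=> s_t; rewrite s_t /= eqxx in hs.
by move=> s_t; rewrite -s_t /= eqxx in ht.
Qed.

Lemma word_labels_inj n : {in language Start n &, injective word_labels}.
Proof.
move=> w v; rewrite !mem_language => /and3P[/eqP sw pw aw] /and3P[/eqP sv pv av].
have headP u k : path trans Start u -> head outC (middle u ++ nseq k outC) != outO.
  case: u => [|l u] /=; first by case: k.
  rewrite /middle /= -/(middle u); case: l => //= /middle_Long ->.
  by case: k.
move/(nseq_cat_inj (headP _ _ pw) (headP _ _ pv)); apply: middle_inj pw aw pv av _.
by rewrite sw sv.
Qed.

Definition parses q w u :=
  [/\ path trans q w, accepting (last q w), Long \notin w & middle w = u].

Lemma parses_cons q l w u : trans q l -> l != Long ->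
  parses l w u -> parses q (l :: w) (letter_labels l ++ u).
Proof.
move=> ql nl [pw aw nw <-]; split; rewrite /= ?ql //.
by rewrite inE eq_sym (negPf nl).
Qed.

(** Every label that may open a block of u determines the letter to be read, and the
local condition on labels is the transition relation on letters. *)
Lemma parse_middle q u : path step (last_label q) u -> last (last_label q) u = outO ->
  q != Long -> (q == Start -> head outC u != outO) -> exists w, parses q w u.
Proof.
have [k] := ubnP (size u); elim: k => // k IHk in q u *.
case: u => [|l u] /=; first by move=> _ _ /eqP acc _ _; exists [::].
rewrite ltnS => le_uk /andP[sl pu] lu nqL qS.
case: l sl pu lu qS => -[] [] sl pu lu qS.
- have [|w /parses_cons-/(_ q) pw] := IHk Opening u le_uk pu lu isT; first by [].
  exists (Opening :: w); apply: pw => //.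
  by case: q nqL qS {sl} => // _ /(_ isT).
- case: u => [|l u] //= in le_uk pu lu *; move: pu lu => /andP[+ pu] lu.
  rewrite /step inE => /eqP lE; rewrite {}lE in pu lu *.
  have [|w /parses_cons-/(_ q) pw] := IHk Short u (ltnW le_uk) pu lu isT; first by [].
  exists (Short :: w); apply: pw => //.
  by case: q sl {nqL qS}.
- have [|w /parses_cons-/(_ q) pw] := IHk Closing u le_uk pu lu isT; first by [].
  exists (Closing :: w); apply: pw => //.
  by case: q sl nqL {qS}.
- by case: q sl {nqL qS}.
Qed.

(** The word is read off from u, and the early openers that the closers in u leave
unmatched become letters [Long]. Maximality of the outer blocks makes the word start
with [Closing] and end with [Opening] unless u is empty. *)
Lemma balanced_word_labels n i u j :
  balanced i u j -> size (block_word i u j) = 2 * n ->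
  head outC u != outO -> last outO u != outC ->
  exists2 w, w \in language Start n & word_labels w = block_word i u j.
Proof.
case=> pT balT le_i sizeT head_u last_u.
have [pu su] : path step outO u /\ step (last outO u) outC.
  move: pT; rewrite /block_word -cats1 -!catA cat_path => /andP[_].
  have -> : last outO (nseq i outO) = outO by elim: (i).
  rewrite cat_path => /andP[-> ]; case: (j) => [|j'] /=; last by case/andP.
  by rewrite andbT.
have lu : last outO u = outO by case: (last outO u) su last_u => -[] [].
have [w [pw aw nw mw]] := @parse_middle Start u pu lu isT (fun=> head_u).
pose k := i - count_mem outC u.
have [cC cO] := count_middle w; rewrite mw in cC cO.
have count_k (l : letter) : count_mem l (w ++ nseq k Long) =
    if l == Long then k else count_mem l w.
  rewrite count_cat count_nseq /= eq_sym; case: eqP => [->|_]; last by rewrite mul0n addn0.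
  by rewrite mul1n (count_memPn nw).
have wT : word_labels (w ++ nseq k Long) = block_word i u j.
  rewrite /word_labels !count_k /=; congr (nseq _ _ ++ _ ++ nseq _ _).
  - by rewrite -cC /k subnKC.
  - rewrite /middle map_cat flatten_cat -/(middle w) mw; elim: k {count_k} => //=.
    by rewrite cats0.
  - move: balT; rewrite /block_word !count_cat !count_nseq /= cC cO /k cC; move: le_i; rewrite cC.
    set a := count_mem Closing w; set b := count_mem Opening w; clear; lia.
have pk : path trans Start (w ++ nseq k Long) /\ accepting (last Start (w ++ nseq k Long)).
  rewrite cat_path last_cat pw; case: (k) => //= k' ; split; last by elim: k'.
  by case: (last Start w) aw => //= _; elim: k'.
exists (w ++ nseq k Long) => //; rewrite mem_language pk.1 pk.2 !andbT.
by have := size_word_labels pk.1; rewrite wT sizeT => /eqP; rewrite eqn_pmul2l // eq_sym.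
Qed.

Lemma word_labels_balanced n w : w \in language Start n ->
  exists i u j, word_labels w = block_word i u j /\ balanced i u j.
Proof.
move=> wL; exists (count_mem Closing w + count_mem Long w), (middle w),
  (count_mem Opening w + count_mem Long w).
split=> //; split; first exact: path_word_labels wL.
  exact: word_labels_count.
by have [-> _] := count_middle w; rewrite leq_addr.
Qed.

(** * The count *)

Lemma mem_stoimenow_avoiding n (M : arcs n) :
  reflect (stoimenow M /\ tame M)
    (M \in stoimenow_avoiding n [:: Pattern P3; Pattern P4; Pattern P5]).
Proof.
rewrite inE; apply: (iffP andP) => [[stM /and4P[no3 no4 no5 _]]|[stM tM]].
  have mM := stoimenow_matching stM; split=> //.
  apply: (avoiding_tame stM).
  - by move/(contains_P3P mM)/(negP no3).
  - by move/(contains_P4P mM)/(negP no4).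
  - by move/(contains_P5P mM)/(negP no5).
have mM := stoimenow_matching stM; have [no3 no4 no5] := tame_avoiding stM tM.
split=> //; apply/and4P; split=> //; apply/negP.
- by move/(contains_P3P mM).
- by move/(contains_P4P mM).
- by move/(contains_P5P mM).
Qed.

Lemma labels_inj n :
  {in stoimenow_avoiding n [:: Pattern P3; Pattern P4; Pattern P5] &,
   injective (@labels n)}.
Proof.
move=> M M' /mem_stoimenow_avoiding[stM tM] /mem_stoimenow_avoiding[stM' tM'] eq_lab.
have eq_label x : label_of M x = label_of M' x.
  by rewrite -!(nth_labels _ outC) eq_lab.
by apply: eq_labels => // x; have [] := eq_label x.
Qed.

(** The label words of the matchings and of the accepted words are the same, and on both
sides they are pairwise different. *)
Lemma card_stoimenow_avoiding n :
  #|stoimenow_avoiding n [:: Pattern P3; Pattern P4; Pattern P5]| = language_size n.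
Proof.
set A := stoimenow_avoiding n _.
rewrite cardE -(size_map (@labels n)) /language_size -(size_map word_labels).
apply/perm_size/uniq_perm.
- rewrite map_inj_in_uniq ?enum_uniq // => M M'; rewrite !mem_enum.
  exact: labels_inj.
- by rewrite (map_inj_in_uniq (@word_labels_inj n)) language_uniq.
move=> T; apply/mapP/mapP => [[M]|[w wL ->]].
  rewrite mem_enum => /mem_stoimenow_avoiding[stM tM] ->.
  have [i [u [j [TE head_u last_u bal]]]] := labels_balanced stM tM.
  have sizeT : size (block_word i u j) = 2 * n by rewrite -TE size_labels.
  have [w wL wE] := balanced_word_labels bal sizeT head_u last_u.
  by exists w; rewrite // wE.
have [i [u [j [TE bal]]]] := word_labels_balanced wL.
have sizeT : size (block_word i u j) = 2 * n.
  move: wL; rewrite mem_language -TE => /and3P[/eqP <- pw _].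
  exact: size_word_labels pw.
exists (realization n i j u); last by rewrite TE labels_realization.
rewrite mem_enum; apply/mem_stoimenow_avoiding.
by split; [exact: stoimenow_realization | exact: tame_realization].
Qed.

Local Open Scope ring_scope.

Theorem theorem4p4 :
  (fun n : nat =>
     #|stoimenow_avoiding n [:: Pattern P3; Pattern P4; Pattern P5]|%:R)
  =1 fps_div (fps_of_poly ((1 - 'X) ^+ 2))
             (fps_of_poly (1 - 3%:R *: 'X + 2%:R *: 'X^2 - 'X^3))
  :> fps rat.
Proof.
move=> n; rewrite card_stoimenow_avoiding; move: n.
by apply: fps_of_recurrent => //; exact: language_size_recurrent.
Qed.
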